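(* For every $\mathrm{PDL}^-$ formula $\varphi$, $\varphi$ is valid on $\mathrm{GREL}_{\mathrm{stsfinlin}}$ if and only if $\varphi$ is derivable in the system $\mathcal H^-$ extended with the axioms (Det-1) $\langle a\rangle\varphi\to[a]\varphi$ and (Det-2) $\langle a\rangle\varphi\to[b]\psi$ for all term variables $a\neq b$ and all $\mathrm{PDL}^-$ formulas $\varphi,\psi$.
   Context: Fix disjoint sets $\mathbb{A}$ (term variables) and $\mathbb{P}$ (formula variables). A generalized structure $M$ consists of a nonempty set $|M|$, a binary relation $U^M\subseteq|M|^2$, relations $a^M\subseteq U^M$ ($a\in\mathbb A$) and sets $p^M\subseteq|M|$ ($p\in\mathbb P$). For $w=a_1\cdots a_n\in\mathbb A^*$ the string structure $W^w$ has universe $\{0,\dots,n\}$, $U^{W^w}=\{(i,j):i\le j\}$, $b^{W^w}=\{(i,i+1):0\le i<n, a_{i+1}=b\}$, $p^{W^w}=\emptyset$. $\mathrm{GREL}_{\mathrm{stfinlin}}$ is the class of generalized structures $M$ with $U^M$ a finite linear order such that replacing every $p^M$ by $\emptyset$ yields a structure isomorphic to $W^w$ for some $w\in\mathbb A^*$. $\mathrm{GREL}_{\mathrm{stsfinlin}}$ is the class of structures obtained from members $M$ of $\mathrm{GREL}_{\mathrm{stfinlin}}$ by replacing $U^M$ with $U^M\setminus\{(x,x):x\in|M|\}$. $\mathrm{PDL}^-$ formulas and terms: $\varphi::=p\mid\varphi\to\varphi\mid\mathtt F\mid[t]\varphi$, $t::=a\mid t;t\mid t+t\mid t^+\mid \varphi?;t\mid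 t;\varphi?$. Abbreviations $\neg,\vee,\wedge,\leftrightarrow,\mathtt T$, $\langle t\rangle\varphi=\neg[t]\neg\varphi$. Semantics: $[\![p]\!]=p^M$, $\to$ and $\mathtt F$ Boolean, $[\![[t]\varphi]\!]=\{x:\forall y((x,y)\in[\![t]\!]\Rightarrow y\in[\![\varphi]\!])\}$, $[\![a]\!]=a^M$, $;$ composition, $+$ union, $\cdot^+$ transitive closure, $[\![\varphi?]\!]=\{(x,x):x\in[\![\varphi]\!]\}$; validity on a class means $[\![\varphi]\!]_M=|M|$ for all members. $\mathcal H^-$: rules modus ponens and necessitation (from $\varphi$ infer $[t]\varphi$); axioms: substitution instances of propositional tautologies; $[t;u]\varphi\leftrightarrow[t][u]\varphi$; $[t+u]\varphi\leftrightarrow[t]\varphi\wedge[u]\varphi$; $[t^+]\varphi\leftrightarrow([t]\varphi\wedge[t][t^+]\varphi)$; $([t]\varphi\wedge[t^+](\varphi\to[t]\varphi))\to[t^+]\varphi$; $[\psi?;t]\varphi\leftrightarrow(\psi\to[t]\varphi)$; $[t;\psi?]\varphi\leftrightarrow[t](\psi\to\varphi)$; $[t](\varphi\to\psi)\to([t]\varphi\to[t]\psi)$; $[t^+]([t^+]\varphi\to\varphi)\to[t^+]\varphi$. *)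

(* Defs.v *)
From Stdlib Require Import Relations.
From Stdlib Require List.
From mathcomp Require Import all_boot.

Set Implicit Arguments.
Unset Strict Implicit.
Unset Printing Implicit Defensive.

(* [A] is the set of term variables, [P] the set of formula variables; as
   distinct type parameters they are disjoint by construction. *)

Record gstruct (A P : Type) := GStruct {
  carrier :> Type;
  carrier_inh : inhabited carrier;
  univ : relation carrier;
  trel : A -> relation carrier;
  trel_univ : forall a x y, trel a x y -> univ x y;
  fset_of : P -> carrier -> Prop
}.

Section Structures.
Variables A P : Type.
Implicit Types (M N : gstruct A P) (w : seq A).

Definition string_rel w (b : A) : relation 'I_(size w).+1 :=
  fun i j => nat_of_ord j = (nat_of_ord i).+1 /\ onth w i = Some b.

Lemma string_rel_univ w b i j : @string_rel w b i j -> (i <= j)%N.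
Proof. by case=> -> _. Qed.

Definition string_struct w : gstruct A P :=
  @GStruct A P 'I_(size w).+1 (inhabits ord0) (fun i j => (i <= j)%N)
    (@string_rel w) (@string_rel_univ w) (fun _ _ => False).

Definition erase M : gstruct A P :=
  @GStruct A P M (carrier_inh M) (@univ _ _ M) (@trel _ _ M) (@trel_univ _ _ M)
    (fun _ _ => False).

Definition isomorphic M N : Prop :=
  exists f : M -> N,
    [/\ bijective f,
        forall x y, univ x y <-> univ (f x) (f y),
        forall a x y, trel a x y <-> trel a (f x) (f y)
      & forall p x, fset_of p x <-> fset_of p (f x)].

Definition finite_linear_order (T : Type) (R : relation T) : Prop :=
  [/\ exists s : seq T, forall x, List.In x s,
      Relation_Definitions.order T R
    & forall x y, R x y \/ R y x].

Definition stfinlin M : Prop :=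
  finite_linear_order (@univ _ _ M) /\
  exists w, isomorphic (erase M) (string_struct w).

(* Keeps the inclusion [trel a] in [univ] after the diagonal is removed. *)
Lemma stfinlin_trel_strict M : stfinlin M ->
  forall a x y, @trel _ _ M a x y -> univ x y /\ x <> y.
Proof.
move=> [_ [w [f [_ _ fa _]]]] a x y axy; split; first exact: trel_univ axy.
move=> exy; have [] := (fa a x y).1 axy.
by rewrite exy => /n_Sn.
Qed.

Definition strictify M (stM : stfinlin M) : gstruct A P :=
  @GStruct A P M (carrier_inh M) (fun x y => univ x y /\ x <> y)
    (@trel _ _ M) (stfinlin_trel_strict stM) (@fset_of _ _ M).

Definition stsfinlin N : Prop :=
  exists (M : gstruct A P) (stM : stfinlin M), N = strictify stM.

End Structures.

Inductive form (A P : Type) : Type :=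
| Var of P
| Imp of form A P & form A P
| Bot
| Box of term A P & form A P
with term (A P : Type) : Type :=
| TVar of A
| Seq of term A P & term A P
| Sum of term A P & term A P
| Plus of term A P
| TestL of form A P & term A P  (* phi?;t *)
| TestR of term A P & form A P. (* t;phi? *)

Arguments Var {A P}.
Arguments Bot {A P}.
Arguments TVar {A P}.

Section Logic.
Variables A P : Type.
Implicit Types (M : gstruct A P) (phi psi : form A P) (t u : term A P).

Definition Neg phi := Imp phi Bot.
Definition And phi psi := Neg (Imp phi (Neg psi)).
Definition Iff phi psi := And (Imp phi psi) (Imp psi phi).
Definition Dia t phi := Neg (Box t (Neg phi)).

Definition rcomp (T : Type) (R S : relation T) : relation T :=
  fun x z => exists y, R x y /\ S y z.
Definition rtest (T : Type) (X : T -> Prop) : relation T :=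
  fun x y => x = y /\ X x.

Fixpoint fsem M phi : M -> Prop :=
  match phi with
  | Var p => fset_of p
  | Imp phi1 phi2 => fun x => fsem phi1 x -> fsem phi2 x
  | Bot => fun _ => False
  | Box t psi => fun x => forall y, tsem t x y -> fsem psi y
  end
with tsem M t : relation M :=
  match t with
  | TVar a => trel a
  | Seq t1 t2 => rcomp (tsem t1) (tsem t2)
  | Sum t1 t2 => union M (tsem t1) (tsem t2)
  | Plus t1 => clos_trans M (tsem t1)
  | TestL psi t1 => rcomp (rtest (fsem psi)) (tsem t1)
  | TestR t1 psi => rcomp (tsem t1) (rtest (fsem psi))
  end.

Definition valid_on (K : gstruct A P -> Prop) phi : Prop :=
  forall M, K M -> forall x : M, fsem phi x.

Inductive pform : Type := PVar of nat | PImp of pform & pform | PBot.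

Fixpoint peval (v : nat -> bool) (q : pform) : bool :=
  match q with
  | PVar n => v n
  | PImp q1 q2 => peval v q1 ==> peval v q2
  | PBot => false
  end.

Definition tautology (q : pform) : Prop := forall v, peval v q.

Fixpoint psubst (s : nat -> form A P) (q : pform) : form A P :=
  match q with
  | PVar n => s n
  | PImp q1 q2 => Imp (psubst s q1) (psubst s q2)
  | PBot => Bot
  end.

Inductive Hminus_axiom : form A P -> Prop :=
| AxTaut q s : tautology q -> Hminus_axiom (psubst s q)
| AxSeq t u phi :
    Hminus_axiom (Iff (Box (Seq t u) phi) (Box t (Box u phi)))
| AxSum t u phi :
    Hminus_axiom (Iff (Box (Sum t u) phi) (And (Box t phi) (Box u phi)))
| AxPlus t phi :
    Hminus_axiom
      (Iff (Box (Plus t) phi) (And (Box t phi) (Box t (Box (Plus t) phi))))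
| AxInd t phi :
    Hminus_axiom
      (Imp (And (Box t phi) (Box (Plus t) (Imp phi (Box t phi))))
           (Box (Plus t) phi))
| AxTestL psi t phi :
    Hminus_axiom (Iff (Box (TestL psi t) phi) (Imp psi (Box t phi)))
| AxTestR t psi phi :
    Hminus_axiom (Iff (Box (TestR t psi) phi) (Box t (Imp psi phi)))
| AxK t phi psi :
    Hminus_axiom (Imp (Box t (Imp phi psi)) (Imp (Box t phi) (Box t psi)))
| AxLob t phi :
    Hminus_axiom
      (Imp (Box (Plus t) (Imp (Box (Plus t) phi) phi)) (Box (Plus t) phi)).

Inductive derivable (Ext : form A P -> Prop) : form A P -> Prop :=
| DAx phi : Hminus_axiom phi -> derivable Ext phi
| DExt phi : Ext phi -> derivable Ext phi
| DMP phi psi :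
    derivable Ext (Imp phi psi) -> derivable Ext phi -> derivable Ext psi
| DNec t phi : derivable Ext phi -> derivable Ext (Box t phi).

Inductive Det_axiom : form A P -> Prop :=
| Det1 (a : A) phi : Det_axiom (Imp (Dia (TVar a) phi) (Box (TVar a) phi))
| Det2 (a b : A) phi psi : a <> b ->
    Det_axiom (Imp (Dia (TVar a) phi) (Box (TVar b) psi)).

End Logic.

(* Main.v *)
(** Truth at a position of a string depends only on the letters and valuations
    from that position on.  Fix a finite Fischer-Ladner closed list [L]
    containing the formula.  Since [t] is never empty, the axioms other than
    induction rewrite every [Box t psi] of [L] into a Boolean combination of
    variables and formulas [Box (TVar a) theta] with [theta] in [L].  Let
    [Omega] be the disjunction of the finitely many [L]-types realized at the
    first position of a string.  By (Det-1) and (Det-2), if [Omega] holds after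
    every letter, then the current type is that of a one-point string or of a
    string extended by one letter; hence [Box (TVar a) Omega] for all letters
    [a] of [L] entails [Omega], and Löb's axiom for the transitive closure of
    the sum of these letters yields [Omega].  A valid formula belongs to every
    realized type, so [Omega] entails it. *)

From Stdlib Require Import Relations Classical ClassicalEpsilon.
From Stdlib Require List.
From mathcomp Require Import all_boot.
From mathcomp Require Import zify.
Require Import Defs.

Set Implicit Arguments.
Unset Strict Implicit.
Unset Printing Implicit Defensive.

Scheme form_term_ind := Induction for form Sort Prop
  with term_form_ind := Induction for term Sort Prop.
Combined Scheme form_term_mutind from form_term_ind, term_form_ind.

(** * Soundness on strings, and transfer of truth between structures *)

Section Semantics.
Variables A P : Type.
Implicit Types (M N : gstruct A P) (phi psi : form A P) (t u : term A P).

Lemma fsem_And M (x : M) phi psi :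
  fsem (And phi psi) x <-> fsem phi x /\ fsem psi x.
Proof. by rewrite /=; split; [move=> ?; apply: NNPP|]; tauto. Qed.

Lemma fsem_Iff M (x : M) phi psi :
  fsem (Iff phi psi) x <-> (fsem phi x <-> fsem psi x).
Proof. by rewrite fsem_And. Qed.

Lemma clos_trans_first (T : Type) (R : relation T) x z : clos_trans T R x z ->
  R x z \/ exists y, R x y /\ clos_trans T R y z.
Proof.
elim=> {x z} [x y Rxy|x y z _ [Rxy|[v [Rxv vy]]] yz _]; first by left.
  by right; exists y.
by right; exists v; split=> //; apply: t_trans vy _.
Qed.

(** The second hypothesis merges the forth and back conditions: the [a]-successors of [f x] are
    exactly the images of those of [x]. Composition, union, closure and tests preserve this
    property; tests mention formulas, hence the simultaneous induction. *)
Lemma fsem_bounded_morphism M N (f : M -> N) :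
  (forall p x, fset_of p x <-> fset_of p (f x)) ->
  (forall a x y', trel a (f x) y' <-> exists y, y' = f y /\ trel a x y) ->
  (forall phi x, fsem phi x <-> fsem phi (f x)) /\
  (forall t x y', tsem t (f x) y' <-> exists y, y' = f y /\ tsem t x y).
Proof.
move=> fP fA; apply: form_term_mutind.
- exact: fP.
- by move=> phi IH1 psi IH2 x /=; rewrite IH1 IH2.
- by [].
- move=> t IHt phi IHphi x /=; split.
    by move=> H y' /IHt [y [-> txy]]; apply/IHphi/H.
  by move=> H y txy; apply/IHphi/H/IHt; exists y.
- exact: fA.
- move=> t IHt u IHu x z' /=; split.
    move=> [y' [/IHt [y [-> txy]] /IHu [z [-> uyz]]]].
    by exists z; split=> //; exists y.
  move=> [z [-> [y [txy uyz]]]]; exists (f y).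
  by split; [apply/IHt; exists y | apply/IHu; exists z].
- move=> t IHt u IHu x y' /=; split.
    by case=> [/IHt|/IHu] [y [-> H]]; exists y; split=> //; [left|right].
  by move=> [y [-> [H|H]]]; [left; apply/IHt|right; apply/IHu]; exists y.
- move=> t IHt x y' /=; split.
    (* The source is generalized so that the intermediate points of a path, which are again images
       under [f], fit the induction hypothesis. *)
    move e: (f x) => x' H.
    elim: H x e => {x' y'} [x' y' txy x e|x' y' z' _ IH1 _ IH2 x e].
      move: txy; rewrite -e => /IHt [y [-> txy]].
      by exists y; split=> //; apply: t_step.
    have [y [ey xy]] := IH1 _ e; have [z [-> yz]] := IH2 _ (esym ey).
    by exists z; split=> //; apply: t_trans yz.
  move=> [y [-> xy]]; elim: xy => {x y} [x y txy|x y z _ IH1 _ IH2].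
    by apply/t_step/IHt; exists y.
  exact: t_trans IH2.
- move=> phi IHphi t IHt x z' /=; split.
    move=> [y' [[<- /IHphi px] /IHt [z [-> txz]]]].
    by exists z; split=> //; exists x.
  move=> [z [-> [y [[<- px] txz]]]]; exists (f x).
  by split; [split=> //; apply/IHphi | apply/IHt; exists z].
- move=> t IHt phi IHphi x z' /=; split.
    move=> [y' [/IHt [z [-> txz]] [<- /IHphi pz]]].
    by exists z; split=> //; exists z.
  move=> [z [-> [y [txy [<- py]]]]]; exists (f y).
  by split; [apply/IHt; exists y | split=> //; apply/IHphi].
Qed.

(* The order relation [univ] plays no role in the semantics of PDL. *)
Definition string_like N : Prop :=
  exists (w : seq A) (f : N -> 'I_(size w).+1), injective f /\
    forall a x y, trel a x y <-> string_rel a (f x) (f y).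

Lemma stsfinlin_string_like N : stsfinlin N -> string_like N.
Proof.
move=> [M [[lin [w [f [bf uf af pf]]]] ->]]; exists w, f.
by split; [apply: bij_inj|].
Qed.

(** Tests occur only attached to a term, so every step of a term reads at least one letter and moves
    right. Together with the bound [n] this gives the well-foundedness behind Löb's axiom. *)
Lemma string_like_increasing N : string_like N ->
  exists (n : nat) (r : N -> nat), (forall x, r x <= n) /\
    forall t x y, tsem t x y -> r x < r y.
Proof.
move=> [w [f [finj fa]]]; exists (size w), (fun x => f x); split.
  by move=> x; rewrite -ltnS.
elim=> [a|t IHt u IHu|t IHt u IHu|t IHt|phi t IHt|t IHt phi] x y /=.
- by move=> /fa [->].
- by move=> [z [/IHt xz /IHu]]; apply: ltn_trans.
- by case; [apply: IHt|apply: IHu].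
- by move=> xy; elim: xy => {x y} [|x y z _ xy _]; [apply: IHt|apply: ltn_trans].
- by move=> [z [[<- _] /IHt]].
- by move=> [z [/IHt + [<- _]]].
Qed.

Lemma Hminus_sound N phi : string_like N -> Hminus_axiom phi ->
  forall x : N, fsem phi x.
Proof.
move=> strN; case=> {phi}.
(* Excluded middle turns the truth of the substituted formulas at [x] into a Boolean valuation. *)
- move=> q s tq x; pose v n : bool :=
    if excluded_middle_informative (fsem (s n) x) then true else false.
  suff E : fsem (psubst s q) x <-> peval v q by apply/E/tq.
  elim: {tq} q => [n|q1 IH1 q2 IH2|] //=; last by rewrite IH1 IH2; split=> /implyP.
  by rewrite /v; case: excluded_middle_informative.
- move=> t u phi x; apply/fsem_Iff; split=> /= H.
    by move=> y xy z yz; apply: H; exists y.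
  by move=> z [y [xy yz]]; apply: H yz.
- move=> t u phi x; apply/fsem_Iff; rewrite fsem_And; split=> /= H.
    by split=> y xy; apply: H; [left|right].
  by move=> y [/(proj1 H)|/(proj2 H)].
- move=> t phi x; apply/fsem_Iff; rewrite fsem_And; split=> /=.
    move=> H; split=> y xy; first exact/H/t_step.
    by move=> z yz; apply: H; apply: t_trans yz; apply: t_step.
  move=> [H1 H2] z xz; have [xz1|[y [xy yz]]] := clos_trans_first xz.
    exact: H1.
  exact: H2 yz.
- move=> t phi x H; have {H} [H1 H2] :=
    (fsem_And x (Box t phi) (Box (Plus t) (Imp phi (Box t phi)))).1 H.
  (* Removing the last step of the path leaves a point reached by [Plus t], where the boxed
     implication applies. *)
  move=> y xy; elim: (clos_trans_tn1 _ _ _ _ xy) => {y xy} [y|y z yz xy]; first exact: H1.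
  by move=> py; apply: H2 yz; [apply: clos_tn1_trans|].
- move=> psi t phi x; apply/fsem_Iff; split=> /= H.
    by move=> px y xy; apply: H; exists x.
  by move=> y [z [[<- px] xy]]; apply: H.
- move=> t psi phi x; apply/fsem_Iff; split=> /= H.
    by move=> y xy py; apply: H; exists y.
  by move=> y [z [xz [<- pz]]]; apply: H.
- by move=> t phi psi x /= H1 H2 y xy; apply: (H1) => //; apply: H2.
- move=> t phi x /= H; have [n [r [rn rt]]] := string_like_increasing strN.
  (* Induction on [n - r y], which drops along each step of [Plus t]. *)
  move=> y; have [k] := ubnP (n - r y); elim: k y => // k IH y ky xy.
  apply: H (xy) _ => z yz; apply: IH; last exact: t_trans yz.
  by have := rt (Plus t) y z yz; have := rn z; lia.
Qed.

Lemma Det_sound N phi : string_like N -> Det_axiom phi ->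
  forall x : N, fsem phi x.
Proof.
move=> [w [f [finj fa]]]; case=> {phi} [a phi|a b phi psi nab] x /= H y xy.
  apply: NNPP => npy; apply: H => z xz pz; apply: npy.
  suff -> : y = z by [].
  move: xy xz => /fa [ey _] /fa [ez _].
  by apply/finj/val_inj; rewrite /= ey ez.
case: H => z xz _; move: xy xz => /fa [_ eb] /fa [_ ea].
by case: nab; move: ea; rewrite eb => -[].
Qed.

Lemma derivable_sound N phi : string_like N -> derivable (@Det_axiom A P) phi ->
  forall x : N, fsem phi x.
Proof.
move=> strN; elim=> {phi}.
- by move=> phi ax; apply: Hminus_sound.
- by move=> phi ax; apply: Det_sound.
- by move=> phi psi _ IH1 _ IH2 x; exact: (IH1 x (IH2 x)).
- by move=> t phi _ IH x y _; exact: IH.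
Qed.

(** Valuations are indexed by [nat], so that prepending a letter shifts them without casts between
    ordinal types. *)
Definition valued_string (w : seq A) (V : nat -> P -> Prop) : gstruct A P :=
  @GStruct A P 'I_(size w).+1 (inhabits ord0) (fun i j => (i <= j)%N)
    (@string_rel A w) (@string_rel_univ A w) (fun p i => V i p).

Lemma valued_string_stfinlin w V : stfinlin (valued_string w V).
Proof.
split; last by exists w, id; split=> //; exists id.
split=> /=.
- exists (enum 'I_(size w).+1) => x.
  have: x \in enum 'I_(size w).+1 by rewrite mem_enum.
  by elim: (enum _) => //= y s IH; rewrite inE => /orP [/eqP ->|/IH]; [left|right].
- split=> [x|x y z|x y] //=; first exact: leq_trans.
  by move=> xy yx; apply/val_inj/anti_leq; rewrite xy.
- by move=> x y; apply/orP/leq_total.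
Qed.

Lemma valued_string_like w V : string_like (valued_string w V).
Proof. by exists w, (fun x : valued_string w V => x); split. Qed.

(** Removing the diagonal of [univ] leaves letters and valuation unchanged, so the identity is a
    bounded morphism onto the strict structure. *)
Lemma valid_valued_string phi w V (x : valued_string w V) :
  valid_on (@stsfinlin A P) phi -> fsem phi x.
Proof.
pose M := valued_string w V; have stM : stfinlin M := valued_string_stfinlin w V.
move=> /(_ (strictify stM)) H.
have [//|a y z|E _] := @fsem_bounded_morphism M (strictify stM) id.
  by split=> [yz|[_ [->]]] //; exists z.
by apply/E/H; exists M, stM.
Qed.

Definition cons_val (Q : P -> Prop) (V : nat -> P -> Prop) (n : nat) : P -> Prop :=
  if n is m.+1 then V m else Q.

(** Edges lead only forward, and the new first position is nobody's successor, so [lift ord0] is a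
    bounded morphism. *)
Lemma fsem_cons_string phi a w Q V (x : valued_string w V) :
  fsem phi x <->
  fsem phi (lift ord0 x : valued_string (a :: w) (cons_val Q V)).
Proof.
have [] // := @fsem_bounded_morphism (valued_string w V)
  (valued_string (a :: w) (cons_val Q V)) (lift ord0).
move=> b i j /=; rewrite /string_rel lift0 /=; split.
  move=> [ej ei]; have [k ek|ej0] := unliftP ord0 j; last by rewrite ej0 in ej.
  exists k; split=> //; split=> //.
  by move: ej; rewrite ek lift0 => -[].
by move=> [k [-> [ek ei]]]; rewrite lift0 ek.
Qed.

End Semantics.

(** * Derivability from hypotheses *)

Section Entailment.
Variables A P : Type.
Implicit Types (phi psi chi : form A P) (t u : term A P).
Implicit Types X Y : form A P -> Prop.
Local Notation derivable := (derivable (@Det_axiom A P)).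

(** Necessitation is confined to theorems, which keeps the deduction theorem true. *)
Inductive entails X : form A P -> Prop :=
| EHyp phi : X phi -> entails X phi
| EThm phi : derivable phi -> entails X phi
| EMP phi psi : entails X (Imp phi psi) -> entails X phi -> entails X psi.

Definition add_hyp X phi : form A P -> Prop := fun psi => X psi \/ psi = phi.

Lemma derivable_taut q (s : seq (form A P)) :
  tautology q -> derivable (psubst (nth Bot s) q).
Proof. by move=> tq; apply/DAx/AxTaut. Qed.

Lemma derivable_K phi psi : derivable (Imp phi (Imp psi phi)).
Proof.
apply: (@derivable_taut (PImp (PVar 0) (PImp (PVar 1) (PVar 0))) [:: phi; psi]).
by move=> v /=; case: (v 0); case: (v 1).
Qed.

Lemma derivable_S phi psi chi : derivable
  (Imp (Imp phi (Imp psi chi)) (Imp (Imp phi psi) (Imp phi chi))).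
Proof.
apply: (@derivable_taut (PImp (PImp (PVar 0) (PImp (PVar 1) (PVar 2)))
  (PImp (PImp (PVar 0) (PVar 1)) (PImp (PVar 0) (PVar 2)))) [:: phi; psi; chi]).
by move=> v /=; case: (v 0); case: (v 1); case: (v 2).
Qed.

Lemma derivable_DNE phi : derivable (Imp (Neg (Neg phi)) phi).
Proof.
apply: (@derivable_taut
  (PImp (PImp (PImp (PVar 0) PBot) PBot) (PVar 0)) [:: phi]).
by move=> v /=; case: (v 0).
Qed.

Lemma entails_derivable phi : entails (fun _ => False) phi -> derivable phi.
Proof. by elim=> // {}phi psi _ H1 _ H2; apply: DMP H1 H2. Qed.

Lemma entails_trans X Y phi :
  entails X phi -> (forall psi, X psi -> entails Y psi) -> entails Y phi.
Proof.
move=> + XY; elim=> {phi}; first exact: XY.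
  by move=> phi; apply: EThm.
by move=> phi psi _ H1 _ H2; apply: EMP H1 H2.
Qed.

Lemma entails_weaken X Y phi :
  entails X phi -> (forall psi, X psi -> Y psi) -> entails Y phi.
Proof. by move=> H XY; apply: entails_trans H _ => psi /XY; apply: EHyp. Qed.

Lemma entails_add X phi psi : entails X phi -> entails (add_hyp X psi) phi.
Proof. by move=> H; apply: entails_weaken H _; left. Qed.

Lemma entails_last X phi : entails (add_hyp X phi) phi.
Proof. by apply: EHyp; right. Qed.

Lemma entails_Imp X phi psi :
  entails (add_hyp X phi) psi -> entails X (Imp phi psi).
Proof.
have KI chi : entails X chi -> entails X (Imp phi chi).
  by move=> H; apply: EMP H; apply/EThm/derivable_K.
elim=> {psi} [psi [/EHyp /KI //|->]|psi /EThm /KI //|psi chi _ H1 _ H2].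
  (* The identity [Imp phi phi] as the combinator S K K. *)
  have := EMP (EMP (EThm X (derivable_S phi (Imp phi phi) phi))
    (EThm X (derivable_K _ _))).
  by apply; apply/EThm/derivable_K.
by apply: EMP H2; apply: EMP H1; apply/EThm/derivable_S.
Qed.

Lemma entails_Bot X phi : entails X Bot -> entails X phi.
Proof.
move=> H; apply: (EMP (EThm X (derivable_DNE phi))); apply: entails_Imp.
exact: entails_add.
Qed.

Lemma entails_contra X phi : entails (add_hyp X (Neg phi)) Bot -> entails X phi.
Proof. by move=> H; apply: (EMP (EThm X (derivable_DNE phi))); apply: entails_Imp. Qed.

Lemma entails_cases X phi psi : entails (add_hyp X phi) psi ->
  entails (add_hyp X (Neg phi)) psi -> entails X psi.
Proof.
move=> /entails_Imp H1 /entails_Imp H2; apply: entails_contra.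
apply: (EMP (entails_last _ _)); apply: (EMP (entails_add _ H2)).
apply: entails_Imp; apply: (EMP (entails_add _ (entails_last _ _))).
by apply: EMP (entails_last _ _); do 2!apply: entails_add.
Qed.

(** A finite substitute for Lindenbaum's lemma: successive case splits yield hypotheses [Y] that
    decide every member of [l]. *)
Lemma entails_case_list X (l : seq (form A P)) psi :
  (forall Y, (forall phi, X phi -> Y phi) ->
     (forall phi, List.In phi l -> Y phi \/ Y (Neg phi)) -> entails Y psi) ->
  entails X psi.
Proof.
elim: l X => [|phi l IH] X H; first exact: H.
by apply: (@entails_cases X phi); apply: IH => Y XY lY; apply: H;
  do [by move=> chi ?; apply: XY; left
     | by move=> chi [<-|/lY //]; [left + right; apply: XY; right]].
Qed.

(** Normality of the box: theorems are necessitated, and axiom K carries modus ponens under the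
    box. *)
Lemma entails_Box X Y t phi : entails Y phi ->
  (forall psi, Y psi -> entails X (Box t psi)) -> entails X (Box t phi).
Proof.
move=> + YX; elim=> {phi}; first exact: YX.
  by move=> phi dphi; apply/EThm/DNec.
move=> phi psi _ H1 _ H2; apply: EMP H2; apply: EMP H1.
exact/EThm/DAx/AxK.
Qed.

Lemma entails_And X phi psi :
  entails X (And phi psi) <-> entails X phi /\ entails X psi.
Proof.
split=> [H|[H1 H2]]; last first.
  apply: entails_Imp; apply: EMP (entails_add _ H2).
  by apply: (EMP (entails_last _ _)); apply: entails_add.
split; apply: entails_contra; apply: (EMP (entails_add _ H)); apply: entails_Imp.
  apply: entails_Bot; apply: EMP (entails_last _ _).
  by apply: entails_add; apply: entails_last.
by apply: entails_add; apply: entails_last.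
Qed.

Lemma entails_Iff X phi psi : derivable (Iff phi psi) ->
  entails X phi <-> entails X psi.
Proof.
by move=> /(EThm X) /entails_And [H1 H2]; split; apply: EMP.
Qed.

(** The negated conjunction of [l], in curried form. *)
Definition refute (l : seq (form A P)) : form A P := foldr (@Imp A P) Bot l.

Lemma entails_refute X l :
  entails (fun phi => X phi \/ List.In phi l) Bot -> entails X (refute l).
Proof.
elim: l X => [|phi l IH] X /= H; first by apply: entails_weaken H _; tauto.
apply: entails_Imp; apply: IH; apply: entails_weaken H _ => psi.
by rewrite /add_hyp => -[?|[?|?]]; auto.
Qed.

Lemma refute_elim X l : entails X (refute l) ->
  (forall phi, List.In phi l -> entails X phi) -> entails X Bot.
Proof.
elim: l => [|phi l IH] //= H Hl; apply: IH.
  by apply: EMP H _; apply: Hl; left.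
by move=> psi ?; apply: Hl; right.
Qed.

Lemma entails_Sum_letters X (a : A) (l : seq A) phi :
  entails X (Box (foldr (fun b => Sum (TVar b)) (TVar a) l) phi) ->
  forall b, List.In b (a :: l) -> entails X (Box (TVar b) phi).
Proof.
elim: l => [|c l IH] /= H b; first by case=> // <-.
have [H1 H2] := (entails_And _ _ _).1 ((entails_Iff X (DAx _ (AxSum _ _ _))).1 H).
by case=> [<-|[<- //|bl]]; apply: IH => //=; auto.
Qed.

(* Löb's axiom for the transitive closure of the sum of the letters of [l]. *)
Lemma letters_Lob (l : seq A) phi :
  entails (fun psi => exists2 a, List.In a l & psi = Box (TVar a) phi) phi ->
  derivable phi.
Proof.
(* There is no empty sum of letters; without letters there are no hypotheses either, so [phi] is
   already a theorem. *)
case: l => [|a l] H; apply: entails_derivable.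
  by apply: entails_weaken H _ => psi [].
pose g : term A P := foldr (fun b => Sum (TVar b)) (TVar a) l.
have step X : entails X (Box (Plus g) phi) -> entails X phi.
  move=> /(entails_Iff X (DAx _ (AxPlus _ _))) /entails_And [H1 _].
  apply: entails_trans H _ => _ [b bl ->].
  exact: entails_Sum_letters H1 _ bl.
(* By [step], the implication from [Box (Plus g) phi] to [phi] is a theorem; its necessitation is
   the premise of Löb's axiom. *)
apply/step/(EMP (EThm _ (DAx _ (AxLob g phi))))/EThm/DNec/entails_derivable.
by apply/entails_Imp/step/entails_last.
Qed.

End Entailment.

(** * Finite Fischer-Ladner closures *)

Section FischerLadner.
Variables A P : Type.
Implicit Types (phi psi chi theta : form A P) (t u : term A P).

Inductive FL_step : form A P -> form A P -> Prop :=
| FLImpl phi psi : FL_step (Imp phi psi) phi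
| FLImpr phi psi : FL_step (Imp phi psi) psi
| FLVar a psi : FL_step (Box (TVar a) psi) psi
| FLSeq t u psi : FL_step (Box (Seq t u) psi) (Box t (Box u psi))
| FLSuml t u psi : FL_step (Box (Sum t u) psi) (Box t psi)
| FLSumr t u psi : FL_step (Box (Sum t u) psi) (Box u psi)
| FLPlus1 t psi : FL_step (Box (Plus t) psi) (Box t psi)
| FLPlus t psi : FL_step (Box (Plus t) psi) (Box t (Box (Plus t) psi))
| FLTestL1 chi t psi : FL_step (Box (TestL chi t) psi) chi
| FLTestL t chi psi : FL_step (Box (TestL chi t) psi) (Box t psi)
| FLTestR t chi psi : FL_step (Box (TestR t chi) psi) (Box t (Imp chi psi)).

Definition FL_closed (L : seq (form A P)) : Prop :=
  forall phi psi, FL_step phi psi -> List.In phi L -> List.In psi L.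

(** [FL_box t psi] leaves out the closure of [psi]. This keeps the recursion structural in [t],
    although the clause for [Plus] enlarges the formula after the box. *)
Fixpoint FL phi : seq (form A P) :=
  phi :: match phi with
  | Imp phi1 phi2 => FL phi1 ++ FL phi2
  | Box t psi => FL_box t psi ++ FL psi
  | _ => [::]
  end
with FL_box t psi : seq (form A P) :=
  Box t psi :: match t with
  | TVar _ => [::]
  | Seq t1 t2 => FL_box t1 (Box t2 psi) ++ FL_box t2 psi
  | Sum t1 t2 => FL_box t1 psi ++ FL_box t2 psi
  | Plus t1 => FL_box t1 psi ++ FL_box t1 (Box (Plus t1) psi)
  | TestL chi t1 => FL chi ++ FL_box t1 psi
  | TestR t1 chi => Imp chi psi :: FL chi ++ FL_box t1 (Imp chi psi)
  end.

Lemma FL_self phi : List.In phi (FL phi).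
Proof. by case: phi => *; left. Qed.

Lemma FL_box_self t psi : List.In (Box t psi) (FL_box t psi).
Proof. by case: t => *; left. Qed.

(** A step can leave [FL_box t psi] only towards [psi], which the surrounding list always
    contains. *)
Lemma FL_closedP : (forall phi, FL_closed (FL phi)) /\
  (forall t psi theta theta', FL_step theta theta' ->
     List.In theta (FL_box t psi) ->
     List.In theta' (FL_box t psi) \/ theta' = psi).
Proof.
have inE theta (l1 l2 : seq (form A P)) :
    List.In theta (l1 ++ l2) <-> List.In theta l1 \/ List.In theta l2.
  exact: List.in_app_iff.
apply: form_term_mutind.
- by move=> p theta theta' st /= [e|//]; rewrite -e in st; inversion st.
- move=> phi IH1 psi IH2 theta theta' st /=; rewrite !inE => -[e|[H|H]].
  + rewrite -e in st; inversion st; subst; have := FL_self theta'; tauto.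
  + by have := IH1 _ _ st H; tauto.
  + by have := IH2 _ _ st H; tauto.
- by move=> theta theta' st /= [e|//]; rewrite -e in st; inversion st.
- move=> t IHt psi IH theta theta' st; have psiL := FL_self psi.
  move=> /=; rewrite !inE => H.
  have {H} : List.In theta (FL_box t psi) \/ List.In theta (FL psi).
    by case: H => [<-|//]; left; apply: FL_box_self.
  by case=> [/(IHt _ _ _ st) [|->]|/(IH _ _ st)]; tauto.
- move=> a psi theta theta' st /= [e|//]; rewrite -e in st; inversion st; tauto.
- move=> t IHt u IHu psi theta theta' st /=; rewrite !inE.
  have H1 := FL_box_self t (Box u psi); have H2 := FL_box_self u psi.
  case=> [e|[/(IHt _ _ _ st) [|->]|/(IHu _ _ _ st)]]; try tauto.
  by rewrite -e in st; inversion st; subst; tauto.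
- move=> t IHt u IHu psi theta theta' st /=; rewrite !inE.
  have H1 := FL_box_self t psi; have H2 := FL_box_self u psi.
  case=> [e|[/(IHt _ _ _ st)|/(IHu _ _ _ st)]]; try tauto.
  by rewrite -e in st; inversion st; subst; tauto.
- move=> t IHt psi theta theta' st /=; rewrite !inE.
  have H1 := FL_box_self t psi; have H2 := FL_box_self t (Box (Plus t) psi).
  (* The exit from the second sublist is [Box (Plus t) psi], the head of the whole list. *)
  case=> [e|[/(IHt _ _ _ st)|/(IHt _ _ _ st) [|->]]]; try tauto.
  by rewrite -e in st; inversion st; subst; tauto.
- move=> chi IHchi t IHt psi theta theta' st /=; rewrite !inE.
  have H1 := FL_box_self t psi; have H2 := FL_self chi.
  case=> [e|[/(IHchi _ _ st)|/(IHt _ _ _ st)]]; try tauto.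
  by rewrite -e in st; inversion st; subst; tauto.
- move=> t IHt chi IHchi psi theta theta' st /=; rewrite !inE.
  have H1 := FL_box_self t (Imp chi psi); have H2 := FL_self chi.
  case=> [e|[e|[/(IHchi _ _ st)|/(IHt _ _ _ st) [|->]]]]; try tauto.
    by rewrite -e in st; inversion st; subst; tauto.
  by rewrite -e in st; inversion st; subst; tauto.
Qed.

Definition letters (L : seq (form A P)) : seq A :=
  List.flat_map (fun phi => if phi is Box (TVar a) _ then [:: a] else [::]) L.

Lemma letters_In L a psi : List.In (Box (TVar a) psi) L -> List.In a (letters L).
Proof. by move=> H; apply/List.in_flat_map; exists (Box (TVar a) psi); split=> //; left. Qed.

End FischerLadner.

(** * Realized types and completeness *)

Section Completeness.
Variables A P : Type.
Implicit Types (phi psi chi theta : form A P) (t u : term A P).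
Implicit Types (L T : seq (form A P)) (X Y : form A P -> Prop).

(** The form taken here by the truth lemma, with provability from [Y] in place of membership in a
    maximal consistent set. *)
Definition settles Y (M : gstruct A P) (x : M) phi : Prop :=
  (fsem phi x -> entails Y phi) /\ (~ fsem phi x -> entails Y (Neg phi)).

(** An equivalence axiom is both sound and derivable, so it transports truth and provability
    alike. *)
Lemma settles_Iff Y (M : gstruct A P) (x : M) phi psi : string_like M ->
  Hminus_axiom (Iff phi psi) -> settles Y x psi -> settles Y x phi.
Proof.
move=> strM ax [H1 H2].
have /fsem_Iff E := Hminus_sound strM ax x.
have E' Z := entails_Iff Z (DAx (@Det_axiom A P) ax).
split; first by move=> /E /H1 /E'.
rewrite E => /H2 H; apply: entails_Imp; apply: (EMP (entails_add _ H)).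
exact/E'/entails_last.
Qed.

Lemma settles_Imp Y (M : gstruct A P) (x : M) phi psi :
  settles Y x phi -> settles Y x psi -> settles Y x (Imp phi psi).
Proof.
move=> [H1 H2] [H3 H4]; split=> /= H.
  have [px|/H2 nphi] := classic (fsem phi x).
    by apply: entails_Imp; apply/entails_add/H3/H.
  apply: entails_Imp; apply: entails_Bot.
  exact: EMP (entails_add _ nphi) (entails_last _ _).
have {}H : fsem phi x /\ ~ fsem psi x by apply: NNPP; tauto.
apply: entails_Imp; apply: (EMP (entails_add _ (H4 H.2))).
by apply: (EMP (entails_last _ _)); apply/entails_add/H1/H.1.
Qed.

Lemma settles_And Y (M : gstruct A P) (x : M) phi psi :
  settles Y x phi -> settles Y x psi -> settles Y x (And phi psi).
Proof.
have HB : settles Y x Bot.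
  by split=> // _; apply/entails_Imp/entails_last.
by move=> H1 H2; do ![apply: settles_Imp => //].
Qed.

(* No term relates a point to itself before reading a letter, so the induction
   on [t] only ever reaches boxes over letters. *)
Lemma settles_FL_closed Y (M : gstruct A P) (x : M) L :
  string_like M -> FL_closed L ->
  (forall p, List.In (Var p) L -> settles Y x (Var p)) ->
  (forall a psi, List.In (Box (TVar a) psi) L -> settles Y x (Box (TVar a) psi)) ->
  forall phi, List.In phi L -> settles Y x phi.
Proof.
move=> strM clL HV HB.
(* For boxes the induction is on the term with [psi] arbitrary: unfolding may enlarge the formula
   after the box, but it shortens the term. *)
suff [] : (forall phi, List.In phi L -> settles Y x phi) /\
  (forall t psi, List.In (Box t psi) L -> settles Y x (Box t psi)) by [].
apply: form_term_mutind.
- exact: HV.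
- by move=> phi IH1 psi IH2 H; apply: settles_Imp; [apply: IH1|apply: IH2];
    apply: clL H; constructor.
- by move=> _; split=> // _; apply/entails_Imp/entails_last.
- by move=> t IHt psi _; apply: IHt.
- exact: HB.
- move=> t IHt u _ psi H; apply: settles_Iff (AxSeq _ _ _) _ => //.
  by apply: IHt; apply: clL H; constructor.
- move=> t IHt u IHu psi H; apply: settles_Iff (AxSum _ _ _) _ => //.
  by apply: settles_And; [apply: IHt|apply: IHu]; apply: clL H; constructor.
- move=> t IHt psi H; apply: settles_Iff (AxPlus _ _) _ => //.
  by apply: settles_And; apply: IHt; apply: clL H; constructor.
- move=> chi IHchi t IHt psi H; apply: settles_Iff (AxTestL _ _ _) _ => //.
  by apply: settles_Imp; [apply: IHchi|apply: IHt]; apply: clL H; constructor.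
- move=> t IHt chi _ psi H; apply: settles_Iff (AxTestR _ _ _) _ => //.
  by apply: IHt; apply: clL H; constructor.
Qed.

Fixpoint types L : seq (seq (form A P)) :=
  if L is phi :: L' then
    [seq phi :: T | T <- types L'] ++ [seq Neg phi :: T | T <- types L']
  else [:: [::]].

Definition literal_of L chi : Prop :=
  exists2 phi, List.In phi L & chi = phi \/ chi = Neg phi.

Lemma types_spec L T : List.In T (types L) ->
  (forall phi, List.In phi L -> List.In phi T \/ List.In (Neg phi) T) /\
  (forall chi, List.In chi T -> literal_of L chi).
Proof.
elim: L T => [|phi L IH] T /=; first by case=> // <-; split.
have lit chi : literal_of L chi -> literal_of (phi :: L) chi.
  by move=> [psi H ?]; exists psi => //; right.
by move=> /List.in_app_iff [] /List.in_map_iff [T' [<- /IH [H1 H2]]];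
  (split=> [psi [<-|/H1] /=|psi /= [<-|/H2 /lit //]];
   [tauto | tauto | exists phi; by [left|auto]]).
Qed.

Definition satisfies (M : gstruct A P) (x : M) T : Prop :=
  forall chi, List.In chi T -> fsem chi x.

Lemma types_cover L (M : gstruct A P) (x : M) :
  exists2 T, List.In T (types L) & satisfies x T.
Proof.
elim: L => [|phi L [T TL sT]]; first by exists [::]; [left|].
have [px|px] := classic (fsem phi x); [exists (phi :: T)|exists (Neg phi :: T)];
  try by move=> chi /= [<-|/sT].
all: apply/List.in_app_iff; [left + right]; exact: List.in_map.
Qed.

(** Being realized is not given as a Boolean test, so the filtering is done by excluded middle at
    each entry. *)
Lemma filter_Prop (T : Type) (Q : T -> Prop) (l : seq T) :
  exists r, forall x, List.In x r <-> List.In x l /\ Q x.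
Proof.
elim: l => [|y l [r IH]]; first by exists [::] => x; split=> // -[].
have [Qy|nQy] := classic (Q y); [exists (y :: r)|exists r] => x /=; rewrite IH.
  by split=> [[<-|]|]; tauto.
by split=> [|[[<-|]]]; tauto.
Qed.

Definition realized T : Prop :=
  exists w V, @satisfies (valued_string w V) ord0 T.

Definition realized_types L (R : seq (seq (form A P))) : Prop :=
  forall T, List.In T R <-> List.In T (types L) /\ realized T.

(** The formula [Omega]: by De Morgan, the disjunction over [R] of the conjunctions of its types. *)
Definition some_type (R : seq (seq (form A P))) : form A P :=
  refute [seq refute T | T <- R].

(** The type of the first position belongs to [R], and [Y] proves each of its members, hence the
    disjunction. *)
Lemma entails_some_type L R Y w V :
  realized_types L R ->
  (forall phi, List.In phi L ->
     settles Y (ord0 : valued_string w V) phi) ->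
  entails Y (some_type R).
Proof.
move=> RP HY.
have [T TL sT] := types_cover L (ord0 : valued_string w V).
have TR : List.In T R by apply/RP; split=> //; exists w, V.
apply: entails_refute; apply: (@refute_elim _ _ _ T).
  by apply: EHyp; right; apply: List.in_map.
move=> chi chiT; have [_ /(_ _ chiT) [phi phiL E]] := types_spec TL.
have [H1 H2] := HY _ phiL.
apply: (@entails_weaken _ _ Y); last by left.
by move: (sT _ chiT); case: E => ->; [apply: H1|apply: H2].
Qed.

Lemma some_type_step L R : FL_closed L -> realized_types L R ->
  entails (fun psi => exists2 a, List.In a (letters L) &
             psi = Box (TVar a) (some_type R)) (some_type R).
Proof.
move=> clL RP.
(* Besides [L], the split decides which letters cannot be read ([dead]) and which realized types are
   impossible after each letter ([excl]). *)
pose dead := [seq Box (TVar a) (@Bot A P) | a <- letters L].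
pose excl := List.flat_map
  (fun a => [seq Box (TVar a) (refute T) | T <- R]) (letters L).
apply: (@entails_case_list _ _ _ (L ++ dead ++ excl)) => Y XY splitY.
have splitL psi : List.In psi L -> Y psi \/ Y (Neg psi).
  by move=> ?; apply/splitY/List.in_app_iff; left.
have splitD a : List.In a (letters L) ->
    Y (Box (TVar a) Bot) \/ Y (Neg (Box (TVar a) Bot)).
  move=> aL; apply/splitY/List.in_app_iff; right; apply/List.in_app_iff; left.
  exact: (List.in_map (fun a => Box (TVar a) (@Bot A P))).
have splitE a T : List.In a (letters L) -> List.In T R ->
    Y (Box (TVar a) (refute T)) \/ Y (Neg (Box (TVar a) (refute T))).
  move=> aL TR; apply/splitY/List.in_app_iff; right.
  apply/List.in_app_iff; right; apply/List.in_flat_map; exists a; split=> //.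
  exact: (List.in_map (fun T => Box (TVar a) (refute T))).
have boxBot a psi : entails Y (Box (TVar a) Bot) -> entails Y (Box (TVar a) psi).
  move=> H; apply: (@entails_Box _ _ _ (fun chi => chi = Bot)) => [|_ -> //].
  by apply: entails_Bot; apply: EHyp.
(* The valuation of the first position is read off from [Y]. *)
pose Q p := Y (Var p).
have settlesVar (w : seq A) (V : nat -> P -> Prop) : V 0 = Q -> forall p,
    List.In (Var p) L -> settles Y (ord0 : valued_string w V) (Var p).
  move=> V0 p /splitL HY; split=> /=; rewrite V0; first exact: EHyp.
  by move=> nYp; apply: EHyp; case: HY.
have [[a aL live]|nolive] :=
    classic (exists2 a, List.In a (letters L) & Y (Neg (Box (TVar a) Bot))).
- have [[T TR YT]|noT] := classic
      (exists2 T, List.In T R & Y (Neg (Box (TVar a) (refute T)))); last first.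
    (* If every realized type were excluded after [a], then [Omega] after [a] would give
       [Box (TVar a) Bot], against [live]. *)
    apply: entails_Bot; apply: (EMP (EHyp live)).
    pose Z chi := chi = some_type R \/ exists2 T, List.In T R & chi = refute T.
    apply: (@entails_Box _ _ _ Z).
      apply: (@refute_elim _ _ _ [seq refute T | T <- R]).
        by apply: EHyp; left.
      move=> _ /List.in_map_iff [T [<- TR]]; apply: EHyp; right; by exists T.
    move=> _ [->|[T TR ->]]; first by apply/EHyp/XY; exists a.
    by apply: EHyp; case: (splitE a T aL TR) => // YT; case: noT; exists T.
  have [TL [w [V sT]]] := (RP T).1 TR.
  (* The type [T] is possible after [a], so each member of it is too; (Det-1) makes it necessary. *)
  have boxT chi : List.In chi T -> entails Y (Box (TVar a) chi).
    move=> chiT; apply: (EMP (EThm _ (DExt (Det1 a chi)))).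
    apply: entails_Imp; apply: (EMP (entails_add _ (EHyp YT))).
    apply: (@entails_Box _ _ _ (fun psi => psi = Neg chi)); last first.
      by move=> _ ->; apply: entails_last.
    apply: entails_refute; apply: (@EMP _ _ _ chi); apply: EHyp; by [left|right].
  (* (Det-2), with the possibility of [T] after [a] as its premise. *)
  have other b psi : a <> b -> entails Y (Box (TVar b) psi).
    move=> nab; apply: (EMP (EThm _ (DExt (Det2 (Neg (refute T)) psi nab)))).
    apply: entails_Imp; apply: (EMP (entails_add _ (EHyp YT))).
    apply: (@entails_Box _ _ _ (fun psi => psi = Neg (Neg (refute T)))); last first.
      by move=> _ ->; apply: entails_last.
    by apply: EMP (EThm _ (derivable_DNE _)) _; apply: EHyp.
  (* Prepending [a] to a string realizing [T] gives a string whose first position is described by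
     [Y]. *)
  apply: (@entails_some_type L R Y (a :: w) (cons_val Q V)) => //.
  apply: settles_FL_closed (valued_string_like _ _) (clL) (settlesVar _ _ erefl) _.
  move=> b psi bL; have psiL : List.In psi L by apply: clL bL; constructor.
  have [<-|nab] := classic (a = b); last first.
    split=> [_|H]; first exact: other.
    by case: H => /= j [_ /= [/nab]].
  have E : fsem (Box (TVar a) psi)
        (ord0 : valued_string (a :: w) (cons_val Q V)) <->
      fsem psi (ord0 : valued_string w V).
    rewrite (fsem_cons_string psi a Q); split=> /= [|H j [ej _]].
      by apply; split.
    by move: H; congr (fsem psi _); apply: val_inj.
  rewrite /settles E; have [/(_ psi psiL) decT _] := types_spec TL.
  split=> H.
    by case: decT => [/boxT //|/sT /(_ H)].
  case: decT => [/sT //|/boxT nH].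
  (* Since [a] can be read, [Box (TVar a) (Neg psi)] refutes [Box (TVar a) psi]. *)
  apply: entails_Imp; apply: (EMP (entails_add _ (EHyp live))).
  apply: (@entails_Box _ _ _ (fun chi => chi = psi \/ chi = Neg psi)).
    by apply: (@EMP _ _ _ psi); apply: EHyp; [right|left].
  by move=> _ [->|->]; [apply: entails_last|apply: entails_add].
(* No letter can be read: the one-point string fits, where every box over a letter holds
   vacuously. *)
- apply: (@entails_some_type L R Y [::] (fun _ => Q)) => //.
  apply: settles_FL_closed (valued_string_like _ _) (clL) (settlesVar _ _ erefl) _.
  move=> b psi bpsiL; have bL := letters_In bpsiL; split=> [_|H].
    apply: boxBot; apply: EHyp; case: (splitD b bL) => // Yb.
    by case: nolive; exists b.
  by case: H => j [_ /=]; rewrite /onth.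
Qed.

Lemma completeness phi :
  valid_on (@stsfinlin A P) phi -> derivable (@Det_axiom A P) phi.
Proof.
move=> valphi; have clL := (FL_closedP A P).1 phi.
have [R RP] := filter_Prop realized (types (FL phi)).
have omega := letters_Lob (some_type_step clL RP).
apply: entails_derivable; apply: entails_contra.
apply: (@refute_elim _ _ _ [seq refute T | T <- R]); first exact: EThm.
move=> _ /List.in_map_iff [T [<- /RP [TL [w [V sT]]]]].
(* Each type decides [phi]; if it contained [Neg phi], the string realizing it would contradict
   validity. *)
have [/(_ phi (FL_self phi)) [phiT|/sT nphi] _] := types_spec TL; last first.
  by case: nphi; apply: valid_valued_string.
by apply: entails_refute; apply: (@EMP _ _ _ phi); apply: EHyp; [left; right|right].
Qed.

End Completeness.

Theorem theorem3 (A P : Type) (phi : form A P) :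
  valid_on (@stsfinlin A P) phi <-> derivable (@Det_axiom A P) phi.
Proof.
split; first exact: completeness.
move=> dphi M /stsfinlin_string_like strM.
exact: derivable_sound.
Qed.
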